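(* Let $\kappa$ be a cardinal satisfying $cf(\kappa)>\omega_1$. If $X$ is a Banach space of density $\kappa$ containing an isomorphic copy of $\ell_1(\omega_1)$, then $X$ does not admit an overcomplete set.
   Context: All Banach spaces are infinite dimensional and over the reals. $dens(X)$ (the density) is the minimal cardinality of a norm dense subset of $X$; $cf(\kappa)$ is the cofinality of $\kappa$. A subset $Y$ of a Banach space $X$ is called overcomplete (in $X$) if $|Y|=dens(X)$ and every $Z\subseteq Y$ with $|Z|=|Y|$ is linearly dense in $X$ (its linear span is norm dense in $X$). *)

(* Defs.v *)
From HB Require Import structures.
From mathcomp Require Import all_boot all_order all_algebra.
From mathcomp Require Import all_classical all_reals all_analysis.
From mathcomp Require wochoice.

Set Implicit Arguments.
Unset Strict Implicit.
Unset Printing Implicit Defensive.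

Import Order.TTheory GRing.Theory Num.Theory.
Import numFieldNormedType.Exports.

Local Open Scope classical_set_scope.
Local Open Scope card_scope.
Local Open Scope ring_scope.

Definition card_lt (T U : Type) (A : set T) (B : set U) : Prop :=
  A #<= B /\ ~ (B #<= A).

(* |A| is the minimal cardinality of a member of P. *)
Definition min_card (T U : Type) (P : set (set T)) (A : set U) : Prop :=
  (exists2 B, P B & A #= B) /\ (forall B, P B -> A #<= B).

(* Cardinals are initial ordinals: well-ordered types all of whose proper
   initial segments have strictly smaller cardinality. *)
Definition is_cardinal (d : Order.disp_t) (K : orderType d) : Prop :=
  wochoice.well_order (<=%O : rel K) /\
  forall x : K, card_lt [set y : K | (y < x)%O] [set: K].

(* omega_1 is the least uncountable ordinal. *)
Definition is_omega1 (d : Order.disp_t) (W : orderType d) : Prop :=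
  [/\ wochoice.well_order (<=%O : rel W), ~ countable [set: W] &
      forall x : W, countable [set y : W | (y < x)%O]].

Definition cofinal (d : Order.disp_t) (K : orderType d) (A : set K) : Prop :=
  forall x : K, exists2 y : K, A y & (x <= y)%O.

(* cf(K) > |B|; the cardinal cf(K) is represented by a subset C of K. *)
Definition cofinality_gt (d : Order.disp_t) (K : orderType d)
    (U : Type) (B : set U) : Prop :=
  exists2 C : set K, min_card (@cofinal d K) C & card_lt B C.

Section Banach.
Context {R : realType}.

Definition span (X : lmodType R) (A : set X) : set X :=
  [set x | exists (n : nat) (a : 'I_n -> R) (v : 'I_n -> X),
    (forall i, A (v i)) /\ x = \sum_(i < n) a i *: v i].

Definition infinite_dimensional (X : lmodType R) : Prop :=
  forall A : set X, finite_set A -> span A <> setT.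

Definition linearly_dense (X : normedModType R) (A : set X) : Prop :=
  dense (span A).

(* dens(X) = |A| *)
Definition has_density (X : normedModType R) (U : Type) (A : set U) : Prop :=
  min_card (@dense X) A.

Definition overcomplete (X : normedModType R) (Y : set X) : Prop :=
  has_density X Y /\
  forall Z : set X, Z `<=` Y -> Z #= Y -> linearly_dense Z.

Definition contains_isomorphic_copy (X E : normedModType R) : Prop :=
  exists T : {linear E -> X}, exists c C : R,
    [/\ 0 < c, 0 < C & forall x : E, c * `|x| <= `|T x| <= C * `|x|].

End Banach.

Section ell1.
Context {R : realType} (I : choiceType).

Definition ell1_pred : {pred (I -> R)} :=
  mem [set f : I -> R | summable setT (EFin \o f)].

Lemma ell1_predP (f : I -> R) :
  reflect (summable setT (EFin \o f)) (f \in ell1_pred).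
Proof. by apply: (iffP idP); rewrite /ell1_pred inE. Qed.

Lemma esum_absZ (a : R) (f : I -> R) : summable setT (EFin \o f) ->
  (\esum_(i in [set: I]) `|(a *: f) i|%:E =
   `|a|%:E * \esum_(i in [set: I]) `|f i|%:E)%E.
Proof.
move=> sf; have [->|a0] := eqVneq a 0.
  rewrite normr0 mul0e esum1 // => i _.
  by rewrite scale0r /= normr0.
have an0 : (0 < `|a|) by rewrite normr_gt0.
have le b (g : I -> R) : b != 0 ->
    (\esum_(i in [set: I]) `|(b *: g) i|%:E <=
     `|b|%:E * \esum_(i in [set: I]) `|g i|%:E)%E.
  move=> b0; apply: ge_ereal_sup => _ /= [F [finF _] <-].
  have -> : (\sum_(i \in F) `|(b *: g) i|%:E =
     `|b|%:E * \sum_(i \in F) `|g i|%:E)%E.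
    rewrite !fsbig_finite //= ge0_sume_distrr //.
    by apply: eq_bigr => i _; rewrite -EFinM -normrM.
  rewrite lee_pmul2l ?lte_fin ?normr_gt0 //.
  by apply: ereal_sup_ubound; exists F.
apply/eqP; rewrite eq_le le //=.
have /(le a^-1) := invr_neq0 a0 => /(_ (a *: f)).
rewrite scalerA mulVf // scale1r normfV => h.
apply: (@le_trans _ _ (`|a|%:E * (`|a|^-1%:E *
   \esum_(i in [set: I]) `|(a *: f) i|%:E))%E).
  by rewrite lee_pmul2l // lte_fin.
by rewrite muleA -EFinM mulfV ?mul1e ?gt_eqF.
Qed.

Lemma ell1_submod_closed : submod_closed ell1_pred.
Proof.
split=> [|a f g /ell1_predP sf /ell1_predP sg]; apply/ell1_predP.
  by rewrite /summable esum1 ?ltry // => i _; rewrite /= normr0.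
apply: (@summableD _ _ _ (EFin \o (a *: f)) (EFin \o g)) => //.
rewrite /summable /= esum_absZ // lte_mul_pinfty //.
Qed.

HB.instance Definition _ := GRing.isSubmodClosed.Build _ _ ell1_pred
  ell1_submod_closed.

Record ell1 := Ell1 { ell1_val :> I -> R; ell1_valP : ell1_val \in ell1_pred }.

HB.instance Definition _ := [isSub for ell1_val].
HB.instance Definition _ := [Choice of ell1 by <:].
HB.instance Definition _ := [SubChoice_isSubLmodule of ell1 by <:].

Definition ell1_norm (f : ell1) : R :=
  fine (\esum_(i in [set: I]) `|f i|%:E).

Lemma ell1_normEFin (f : ell1) :
  ((ell1_norm f)%:E = \esum_(i in [set: I]) `|f i|%:E)%E.
Proof. by rewrite fineK //; have /ell1_predP := ell1_valP f; rewrite summableE. Qed.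

Lemma ell1_normD (f g : ell1) : ell1_norm (f + g) <= ell1_norm f + ell1_norm g.
Proof.
rewrite -lee_fin EFinD !ell1_normEFin -esumD //; apply: le_esum => i _.
by rewrite -EFinD lee_fin ler_normD.
Qed.

Lemma ell1_normZ (a : R) (f : ell1) : ell1_norm (a *: f) = `|a| * ell1_norm f.
Proof.
apply: EFin_inj; rewrite EFinM !ell1_normEFin.
exact: (esum_absZ a (elimT (ell1_predP f) (ell1_valP f))).
Qed.

Lemma ell1_norm0_eq0 (f : ell1) : ell1_norm f = 0 -> f = 0.
Proof.
move=> f0; apply: val_inj; apply/funext => i /=; apply/normr0_eq0/eqP.
rewrite eq_le normr_ge0 andbT -lee_fin -f0 ell1_normEFin.
apply: ereal_sup_ubound; exists [set i]; last by rewrite fsbig_set1.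
by split=> //; exact: finite_set1.
Qed.

HB.instance Definition _ := @Lmodule_isNormed.Build R ell1 ell1_norm
  ell1_normD ell1_normZ ell1_norm0_eq0.

Lemma ell1_normE (f : ell1) :
  `|f| = fine (\esum_(i in [set: I]) `|f i|%:E).
Proof. by []. Qed.

End ell1.

Arguments ell1 R I : clear implicits.

(* Main.v *)
Require Import Defs.
From HB Require Import structures.
From mathcomp Require Import all_boot all_order all_algebra finmap.
From mathcomp Require Import all_classical all_reals all_analysis.
From mathcomp Require Import ring lra.
From mathcomp Require wochoice.

(* Random signs turn the copy of ell_1(omega_1) in X into norm-bounded nonzero
   functionals f_w on X, w < omega_1, such that each x in X satisfies
   f_w(x) <> 0 for only countably many w: with e_w the unit vectors of the copy,
   the functional sum_w a_w (delta_w (x) e_w) |-> sum_w a_w is dominated on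
   finitely supported families u : W -> X by the Rademacher average
   E |sum_w +-u_w|, so it extends by Hahn-Banach; on families c_w x this average
   is at most |x| (sum_w c_w^2)^(1/2).
   If Y were overcomplete, it would be the union over w < omega_1 of its
   intersections with the kernels of the f_w. As cf(kappa) > omega_1, one of
   these intersections has cardinality kappa; it lies in a proper closed
   subspace, hence is not linearly dense. *)

Set Implicit Arguments.
Unset Strict Implicit.
Unset Printing Implicit Defensive.

Import Order.TTheory GRing.Theory Num.Theory.
Import numFieldNormedType.Exports.

Local Open Scope classical_set_scope.
Local Open Scope card_scope.
Local Open Scope ring_scope.

(** * Cardinals *)

Lemma card_le_inj (T U : Type) (A : set T) (B : set U) (f : T -> U) :
  (forall x, A x -> B (f x)) ->
  (forall x y, A x -> A y -> f x = f y -> x = y) -> A #<= B.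
Proof.
move=> fAB finj; apply: (@card_le_trans _ _ _ (f @` A)).
  have /card_eqPle[] // : f @` A #= A.
  by apply: inj_card_eq => x y /set_mem Ax /set_mem Ay; exact: finj.
by apply: subset_card_le => _ [x Ax <-]; exact: fAB.
Qed.

Lemma card_le_fun (T U : Type) (A : set T) (B : set U) (u : U) : A #<= B ->
  exists f : T -> U, (forall x, A x -> B (f x)) /\
    (forall x y, A x -> A y -> f x = f y -> x = y).
Proof.
move=> /card_leP[g].
pose f x := if pselect (A x) is left h then val (g (SigSub (mem_set h))) else u.
exists f; split=> [x Ax|x y Ax Ay]; rewrite /f; case: pselect => // h.
  by apply: set_mem; exact: valP.
case: pselect => // h' /val_inj /(@inj _ _ _ g).
by rewrite !in_setT => /(_ isT isT)/(congr1 val).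
Qed.

(* A transfinite recursion along lt picks distinct values of B for the
   successive elements of A until one of the two sets is exhausted. *)
Lemma wf_card_le (T U : Type) (lt : T -> T -> Prop) (A : set T) (B : set U) :
  well_founded lt -> (forall x y, x <> y -> lt x y \/ lt y x) ->
  A #<= B \/ exists2 x, A x & B #<= [set y | A y /\ lt y x].
Proof.
move=> wf tot; apply: contrapT => /not_orP[nAB nBA].
have [[u _]|B0] := pselect (exists u, B u); last first.
  have [[x Ax]|A0] := pselect (exists x, A x).
    apply: nBA; exists x => //; rewrite (_ : B = set0) ?card_ge0//.
    by apply/seteqP; split=> // z Bz; apply: B0; exists z.
  apply: nAB; rewrite (_ : A = set0) ?card_ge0//.
  by apply/seteqP; split=> // z Az; apply: A0; exists z.
pose P (x : T) (g : forall y, lt y x -> U) (v : U) :=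
  B v /\ forall y (h : lt y x), A y -> g y h <> v.
(* The default [u] is taken only where [B] is exhausted; [Pf] excludes this at the points of [A]. *)
pose F x g := if pselect (exists v, P x g v) is left e then projT1 (cid e) else u.
pose f := Fix wf (fun=> U) F.
have fE x : f x = F x (fun y _ => f y).
  rewrite /f Fix_eq// => z g1 g2 g12; congr F.
  by apply: functional_extensionality_dep => y; apply/funext => h; exact: g12.
have Pf x : A x -> P x (fun y _ => f y) (f x).
  move=> Ax; rewrite [f x]fE /F; case: pselect => [e|ne]; first by case: cid.
  exfalso; apply: nBA; exists x => //.
  apply: (@card_le_trans _ _ _ (f @` [set y | A y /\ lt y x])).
    apply: subset_card_le => v Bv; apply: contrapT => nv; apply: ne.
    by exists v; split=> // y h Ay yv; apply: nv; exists y.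
  exact: card_image_le.
apply: nAB; apply: (@card_le_inj _ _ _ _ f) => [x /Pf[]//|x y Ax Ay fxy].
apply: contrapT => /tot[h|h].
- by have [_ /(_ _ h Ax)] := Pf _ Ay.
- by have [_ /(_ _ h Ay)] := Pf _ Ax; apply.
Qed.

(** Hilbert's hotel: [A] contains a sequence of distinct points, and shifting it by one place frees
    [f 0] for [x]. *)
Lemma infinite_setU1_card_le (T : Type) (A : set T) (x : T) :
  infinite_set A -> A `|` [set x] #<= A.
Proof.
move=> /[dup] Ai /infiniteP NA.
have [a Aa] := infinite_setN0 Ai.
have [f [fA finj]] := card_le_fun a NA.
have [Ax|nAx] := pselect (A x).
  by apply: subset_card_le => y [//|->].
pose shift y := if pselect (exists n, f n = y) is left e
                then f (projT1 (cid e)).+1 else y.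
have shiftf n : shift (f n) = f n.+1.
  rewrite /shift; case: pselect => [e|]; last by case; exists n.
  by case: cid => m /= /finj ->.
have shiftn y : ~ (exists n, f n = y) -> shift y = y.
  by rewrite /shift; case: pselect.
pose g y := if pselect (y = x) then f 0%N else shift y.
have gA y : A y -> g y = shift y.
  by move=> Ay; rewrite /g; case: pselect => // yx; case: nAx; rewrite -yx.
have gx : g x = f 0%N by rewrite /g; case: pselect.
have sA y : A y -> A (shift y).
  have [[n <-] _|ny Ay] := pselect (exists n, f n = y).
    by rewrite shiftf; exact: fA.
  by rewrite shiftn.
have s0 y : shift y <> f 0%N.
  have [[n <-]|ny] := pselect (exists n, f n = y).
    by rewrite shiftf => /finj; move=> /(_ Logic.I Logic.I).
  by rewrite shiftn// => yf; apply: ny; exists 0%N.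
have sinj y z : shift y = shift z -> y = z.
  have [[n <-]|ny] := pselect (exists n, f n = y);
    have [[m <-]|mz] := pselect (exists n, f n = z).
  - by rewrite !shiftf => /finj -/(_ Logic.I Logic.I) [->].
  - by rewrite shiftf shiftn// => e; case: mz; exists n.+1.
  - by rewrite shiftf shiftn// => e; case: ny; exists m.+1.
  - by rewrite !shiftn.
apply: (@card_le_inj _ _ _ _ g) => [y [Ay|->]|y z].
- by rewrite gA//; exact: sA.
- by rewrite gx; exact: fA.
move=> [Ay|yx] [Az|zx]; rewrite ?yx ?zx //.
- by rewrite !gA//; exact: sinj.
- by rewrite (gA y)// gx => /s0.
- by rewrite (gA z)// gx => /esym/s0.
Qed.

(** * Squares of initial segments of a well-order *)

Section well_ordered.
Variables (d : Order.disp_t) (K : orderType d).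
Hypothesis Kwo : wochoice.well_order (<=%O : rel K).

Lemma well_order_wf : well_founded (fun x y : K => (x < y)%O).
Proof.
move=> x0; apply: contrapT => nx0.
pose N := [pred x | `[< ~ Acc (fun x y : K => (x < y)%O) x >]].
have [z [[zA zmin] _]] : exists! z, wochoice.minimum_of <=%O N z.
  by apply: Kwo; exists x0; rewrite inE.
move: zA; rewrite inE; apply; constructor => y yz.
apply: contrapT => ny; have := zmin y; rewrite inE.
by move=> /(_ ny); rewrite leNgt yz.
Qed.

Let seg (x : K) := [set y : K | (y < x)%O].

Lemma segment_card_le (U : Type) (B : set U) :
  [set: K] #<= B \/ exists x, B #<= seg x.
Proof.
have [|AB|[x _ Bx]] := @wf_card_le K U _ [set: K] B well_order_wf; last 2 first.
- by left.
- right; exists x; apply: (card_le_trans Bx).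
  by apply: subset_card_le => y [].
by move=> x y /eqP; case: ltgtP => // ? _; [left|right].
Qed.

(** Comparing maxima first confines the predecessors of a pair to the square of a closed initial
    segment, which the lexicographic order alone would not do. *)
Definition godel_lt (p q : K * K) : Prop :=
  let m := Order.max p.1 p.2 in let n := Order.max q.1 q.2 in
  (m < n)%O \/ m = n /\ ((p.1 < q.1)%O \/ p.1 = q.1 /\ (p.2 < q.2)%O).

Lemma godel_lt_wf : well_founded godel_lt.
Proof.
(* The maximum and the two coordinates are named separately, for three nested inductions in the
   order of comparison. *)
suff H : forall m a b p, Order.max p.1 p.2 = m -> p.1 = a -> p.2 = b ->
    Acc godel_lt p by move=> p; exact: H.
elim/(well_founded_ind well_order_wf) => m IHm.
elim/(well_founded_ind well_order_wf) => a IHa.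
elim/(well_founded_ind well_order_wf) => b IHb p pm pa pb.
constructor => q [|[qp [|[q1 q2]]]].
- by rewrite pm => qm; exact: (IHm _ qm).
- by rewrite pa => qa; apply: (IHa _ qa) => //; rewrite qp.
- by move: q2; rewrite pb => qb; apply: (IHb _ qb); rewrite ?qp ?q1.
Qed.

Lemma godel_lt_total p q : p <> q -> godel_lt p q \/ godel_lt q p.
Proof.
case: p q => a b [a' b'] ne; rewrite /godel_lt /=.
case: (ltgtP (Order.max a b) (Order.max a' b')) => [||->]; [by left; left|by right; left|].
case: (ltgtP a a') ne => [||->] ne; [by left; right; auto|by right; right; auto|].
case: (ltgtP b b') ne => [||->] // _; [left|right]; right; auto.
Qed.

(** Hessenberg's theorem, by induction on [x]: if the square does not embed in [seg x], then [seg x]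
    embeds in the [godel_lt]-predecessors of some pair, hence in the square of a shorter segment,
    which by induction is no larger than that segment. *)
Lemma segment_setX_card_le x : infinite_set (seg x) ->
  seg x `*` seg x #<= seg x.
Proof.
elim/(well_founded_ind well_order_wf): x => x IH inf.
(* If [seg x] is no larger than an earlier infinite segment, the induction hypothesis transfers
   along the injection. *)
have sub y : (y < x)%O -> infinite_set (seg y) -> seg x #<= seg y ->
    seg x `*` seg x #<= seg x.
  move=> yx infy xy; have [f [fy finj]] := card_le_fun x xy.
  apply: (@card_le_trans _ _ _ (seg y `*` seg y)).
    apply: (@card_le_inj _ _ _ _ (fun p => (f p.1, f p.2))).
      by move=> p [? ?]; split; exact: fy.
    move=> [a b] [a' b'] [/= ? ?] [/= ? ?] [] /finj e1 /finj e2.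
    by rewrite e1// e2.
  apply: card_le_trans (IH _ yx infy) _.
  by apply: subset_card_le => z /= zy; exact: lt_trans yx.
have [//|[[a b] [/= ax bx] le]] :=
  @wf_card_le _ _ _ (seg x `*` seg x) (seg x) godel_lt_wf godel_lt_total.
(* The endpoint [m] belongs to [S] because a pair below [(a, b)] can also have maximum [m];
   Hilbert's hotel absorbs it later. *)
pose m := Order.max a b; pose S := seg m `|` [set m].
have mx : (m < x)%O by rewrite gt_max ax.
have {}le : seg x #<= S `*` S.
  apply: (card_le_trans le); apply: subset_card_le => -[c e] [_ /= ge].
  have : (Order.max c e <= m)%O by case: ge => [/ltW|[->]].
  rewrite ge_max => /andP[]; rewrite !le_eqVlt => /orP[/eqP->|cm] /orP[/eqP->|em];
    by split; (try by left); right.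
have [finm|infm] := pselect (finite_set (seg m)).
  exfalso; apply: inf; apply: (card_le_finite le).
  by apply: finite_setX; rewrite finite_setU; split=> //; exact: finite_set1.
apply: (sub m) => //; apply: (card_le_trans le).
have [f [fS finj]] := card_le_fun x (infinite_setU1_card_le m infm).
apply: card_le_trans (IH _ mx infm).
apply: (@card_le_inj _ _ _ _ (fun p => (f p.1, f p.2))).
  by move=> p [? ?]; split; exact: fS.
move=> [c e] [c' e'] [/= ? ?] [/= ? ?] [] /finj e1 /finj e2.
by rewrite e1// e2.
Qed.

End well_ordered.

(** If every [A u] were smaller than [K], each would embed in a proper segment. Fewer than [cf(K)]
    segments have a common bound [z], so [K] would embed in the square of the segment below [z],
    hence in that segment, against [is_cardinal]. *)
Lemma cofinality_pigeonhole (d : Order.disp_t) (K : orderType d) (U : Type)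
    (B : set U) (A : U -> set K) :
  is_cardinal K -> infinite_set B -> cofinality_gt K B ->
  (forall k, exists2 u, B u & A u k) -> exists2 u, B u & [set: K] #<= A u.
Proof.
move=> [Kwo Klt] Binf [C [_ Cmin] [BC nCB]] cov; apply: contrapT => nA.
have [u0 Bu0] := infinite_setN0 Binf.
have [k0 Bk0] : exists x, B #<= [set y : K | (y < x)%O].
  have [KB|//] := segment_card_le Kwo B.
  by exfalso; apply: nCB; apply: card_le_trans KB; exact: card_leT.
have bnd u : B u -> exists x, A u #<= [set y : K | (y < x)%O].
  move=> Bu; have [KA|//] := segment_card_le Kwo (A u).
  by exfalso; apply: nA; exists u.
have /choice[x xP] : forall u, exists x, B u -> A u #<= [set y : K | (y < x)%O].
  by move=> u; have [/bnd[x]|] := pselect (B u); [exists x|exists k0].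
(* Taking the maximum with [k0] makes the segment below [z] large enough for [B] as well. *)
pose D := (fun u => Order.max (x u) k0) @` B.
(* Without such a [z] the set [D] would be cofinal, giving [C #<= D] and [D #<= B]. *)
have [z zD] : exists z, forall u, B u -> (Order.max (x u) k0 < z)%O.
  apply: contrapT => nz; apply: nCB; apply: (@card_le_trans _ _ _ D).
    apply: Cmin => z; apply: contrapT => nD; apply: nz; exists z => u Bu.
    by rewrite ltNge; apply/negP => zu; apply: nD; eexists; [exists u|].
  exact: card_image_le.
have Bz : B #<= [set y : K | (y < z)%O].
  apply: (card_le_trans Bk0); apply: subset_card_le => y /= yk.
  by apply: (lt_trans yk); have := zD _ Bu0; rewrite gt_max => /andP[].
have Az u : B u -> A u #<= [set y : K | (y < z)%O].
  move=> Bu; apply: (card_le_trans (xP _ Bu)); apply: subset_card_le => y /= yk.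
  by apply: (lt_trans yk); have := zD _ Bu; rewrite gt_max => /andP[].
have [g [gz ginj]] := card_le_fun k0 Bz.
have /choice[h hP] : forall u, exists h : K -> K, B u ->
    (forall k, A u k -> (h k < z)%O) /\
    (forall k l, A u k -> A u l -> h k = h l -> k = l).
  move=> u; have [Bu|] := pselect (B u); last by exists id.
  by have [h] := card_le_fun k0 (Az _ Bu); exists h.
have /choice[w wP] : forall k, exists u, B u /\ A u k.
  by move=> k; have [u] := cov k; exists u.
have zinf : infinite_set [set y : K | (y < z)%O].
  by move=> /(card_le_finite Bz).
case: (Klt z) => _; apply; apply: card_le_trans (segment_setX_card_le Kwo zinf).
(* The first coordinate encodes a member of the cover containing [k], the second the place of [k]
   inside it. *)
apply: (@card_le_inj _ _ _ _ (fun k => (g (w k), h (w k) k))).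
  by move=> k _; have [? ?] := wP k; split; [exact: gz|exact: (hP _ _).1].
move=> k l _ _ [gw hw]; have [Bk Ak] := wP k; have [Bl Al] := wP l.
move: (ginj _ _ Bk Bl gw) => e; move: hw; rewrite -e; apply: (hP _ _).2 => //.
by rewrite e.
Qed.

(** * The Hahn-Banach theorem *)

Section Hahn_Banach.
Context {R : realType} {V : lmodType R}.

(** The inequality for [a > 0] already yields equality, on applying it to [a^-1]. *)
Definition sublinear (p : V -> R) : Prop :=
  (forall x y, p (x + y) <= p x + p y) /\
  (forall a x, 0 < a -> p (a *: x) <= a * p x).

Lemma sublinear0 p : sublinear p -> p 0 = 0.
Proof.
move=> [pD pZ]; apply/eqP; rewrite eq_le; apply/andP; split.
  by have := pZ 2^-1 0 ltac:(lra); rewrite scaler0; lra.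
by have := pD 0 0; rewrite addr0; lra.
Qed.

Lemma sublinearN p x : sublinear p -> - p (- x) <= p x.
Proof.
move=> ps; have := ps.1 x (- x); rewrite subrr (sublinear0 ps); lra.
Qed.

Section infimum.
Variables (I : Type) (i0 : I) (F : V -> I -> R).
Hypothesis Fbnd : forall x, exists b, forall i, b <= F x i.
Hypothesis FD : forall x y i j, exists k, F (x + y) k <= F x i + F y j.
Hypothesis FZ : forall a x i, 0 < a -> exists k, F (a *: x) k <= a * F x i.

Let q x := inf (range (F x)).

Lemma inf_family_le x i : q x <= F x i.
Proof.
apply: ge_inf; last by exists i.
by have [b bF] := Fbnd x; exists b => _ [j _ <-].
Qed.

Lemma le_inf_family x b : (forall i, b <= F x i) -> b <= q x.
Proof.
by move=> bF; apply: lb_le_inf; [exists (F x i0), i0|move=> _ [i _ <-]].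
Qed.

(** Serves for infima over a chain, over multiples of one vector, and over the domain of a
    functional to be extended. As [FD] treats every pair of indices, the two infima on the right can
    be taken one after the other. *)
Lemma sublinear_inf : sublinear q.
Proof.
split=> [x y|a x a0].
  rewrite -lerBlDr; apply: le_inf_family => i.
  rewrite lerBlDr -lerBlDl; apply: le_inf_family => j.
  have [k] := FD x y i j; have := inf_family_le (x + y) k; lra.
rewrite -ler_pdivrMl //; apply: (@le_inf_family x) => i; rewrite ler_pdivrMl //.
have [k] := FZ x i a0; exact: le_trans (inf_family_le _ _).
Qed.

End infimum.

(* A pointwise minimal sublinear functional q is additive: otherwise
   z |-> inf_(t >= 0) (q (z + t x) - t q x) would be strictly below q. *)
Lemma sublinear_ge_scalar (p : V -> R) : sublinear p ->
  exists L : {scalar V}, forall x, L x <= p x.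
Proof.
move=> ps; pose D (q : V -> R) := sublinear q /\ forall x, q x <= p x.
pose T := {q : V -> R | D q}.
(* The order is reversed, so that a maximal element from Zorn's lemma is a pointwise minimal
   functional. *)
pose below (q r : T) := `[< forall x, sval r x <= sval q x >].
have [||A Atot|[q [qs qp]] qmin] :=
  @ZL_preorder T (exist D p (conj ps (fun x => lexx (p x)))) below.
- by move=> q; apply/asboolP.
- move=> r s t /asboolP rs /asboolP st; apply/asboolP => x.
  exact: le_trans (st x) (rs x).
(* The empty chain is bounded by [p]; the infimum needs a nonempty index type. *)
- have [[q0 Aq0]|A0] := pselect (exists q, A q); last first.
    exists (exist D p (conj ps (fun x => lexx (p x)))) => q Aq.
    by exfalso; apply: A0; exists q.
  pose F (x : V) (q : {q | A q}) := sval (sval q) x.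
  have Fbnd x : exists b, forall i, b <= F x i.
    exists (- p (- x)) => -[[q [qs qp]] Aq]; rewrite /F /=.
    by apply: le_trans (sublinearN x qs); rewrite lerN2.
  have FD x y i j : exists k, F (x + y) k <= F x i + F y j.
    have [/asboolP ij|/asboolP ji] := Atot _ _ (svalP i) (svalP j).
      exists j; apply: le_trans ((svalP (sval j)).1.1 x y) _.
      by rewrite lerD2r; exact: ij.
    exists i; apply: le_trans ((svalP (sval i)).1.1 x y) _.
    by rewrite lerD2l; exact: ji.
  have FZ a x i : 0 < a -> exists k, F (a *: x) k <= a * F x i.
    by move=> a0; exists i; exact: (svalP (sval i)).1.2.
  pose i0 : {q | A q} := exist _ q0 Aq0.
  have qs := sublinear_inf i0 Fbnd FD FZ.
  have qp x : inf (range (F x)) <= p x.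
    by apply: le_trans (inf_family_le Fbnd x i0) _; exact: (svalP q0).2.
  exists (exist D _ (conj qs qp)) => q Aq; apply/asboolP => x /=.
  exact: (inf_family_le Fbnd x (exist _ q Aq)).
have qD x z : q (z + x) = q z + q x.
  pose nneg (t : R) : Prop := 0 <= t.
  pose F (z : V) (t : {t | nneg t}) := q (z + sval t *: x) - sval t * q x.
  have qZ t : 0 <= t -> t * q x <= q (t *: x).
    rewrite le_eqVlt => /orP[/eqP <-|t0].
      by rewrite mul0r scale0r (sublinear0 qs).
    rewrite -ler_pdivlMl// (le_trans _ (qs.2 _ _ _)) ?invr_gt0//.
    by rewrite scalerA mulVf ?gt_eqF// scale1r.
  have Fbnd y : exists b, forall i, b <= F y i.
    exists (- q (- y)) => -[t t0]; rewrite /F /=.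
    have := qs.1 (y + t *: x) (- y); rewrite addrC addKr.
    by have := qZ _ t0; lra.
  have FD y y' i j : exists k, F (y + y') k <= F y i + F y' j.
    exists (exist nneg _ (addr_ge0 (svalP i) (svalP j))); rewrite /F /=.
    have := qs.1 (y + sval i *: x) (y' + sval j *: x).
    by rewrite addrACA -scalerDl; lra.
  have FZ a y i : 0 < a -> exists k, F (a *: y) k <= a * F y i.
    move=> a0; exists (exist nneg _ (mulr_ge0 (ltW a0) (svalP i))); rewrite /F /=.
    rewrite mulrBr mulrA lerD2r -scalerA -scalerDr.
    exact: qs.2.
  pose i0 : {t | nneg t} := exist nneg _ (lexx 0).
  have rs := sublinear_inf i0 Fbnd FD FZ.
  have rq y : inf (range (F y)) <= q y.
    apply: le_trans (inf_family_le Fbnd y i0) _.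
    by rewrite /F /= scale0r mul0r addr0 subr0.
  have rp y := le_trans (rq y) (qp y).
  (* Minimality puts [q] below the infimum, whose index [t = 1] gives [q z <= q (z + x) - q x]. *)
  have /asboolP qr := qmin (exist D _ (conj rs rp)) (asboolT rq).
  have := qr z => /=; have := inf_family_le Fbnd z (exist nneg 1 ler01).
  rewrite /F /= scale1r mul1r; have := qs.1 z x.
  by move=> h1 h2 h3; apply/eqP; rewrite eq_le h1 /=; lra.
have q0 := sublinear0 qs.
have qN x : q (- x) = - q x by have := qD (- x) x; rewrite subrr q0; lra.
have qZ a x : 0 < a -> q (a *: x) = a * q x.
  move=> a0; apply/eqP; rewrite eq_le qs.2//=.
  by have := qs.2 a (- x) a0; rewrite scalerN !qN; lra.
have qlin : scalar q.
  move=> a x y; rewrite qD; congr (_ + _).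
  have [a0|a0|->] := ltgtP a 0; last by rewrite scale0r mul0r.
  - rewrite -[a]opprK scaleNr qN qZ ?oppr_gt0// !mulNr; done.
  - exact: qZ.
pose qL := GRing.isLinear.Build R V R *%R q qlin.
pose L : {scalar V} := HB.pack q qL.
by exists L.
Qed.

(** The infimum over [e] of [p (v - j e) + l e] is finite since [l] is dominated, and it is
    sublinear. A linear [L] below it satisfies [L <= p] by taking [e = 0], and [L (j e) <= l e] by
    taking [v = j e]; replacing [e] by [- e] gives equality. *)
Lemma Hahn_Banach (E : lmodType R) (j : {linear E -> V}) (l : E -> R)
    (p : V -> R) :
  sublinear p -> scalar l -> (forall e, l e <= p (j e)) ->
  exists L : {scalar V}, (forall x, L x <= p x) /\ forall e, L (j e) = l e.
Proof.
move=> ps llin lp.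
have lD e e' : l (e + e') = l e + l e'.
  by rewrite -[e]scale1r llin mul1r scale1r.
have l0 : l 0 = 0 by have := lD 0 0; rewrite addr0; lra.
have lZ a e : l (a *: e) = a * l e by have := llin a e 0; rewrite !addr0 l0; lra.
have lN e : l (- e) = - l e by rewrite -scaleN1r lZ mulN1r.
pose F (v : V) (e : E) := p (v - j e) + l e.
have Fbnd y : exists b, forall i, b <= F y i.
  exists (- p (- y)) => e; rewrite /F /=.
  have := ps.1 (y - j e) (- y); rewrite addrC addKr.
  by have := lp (- e); rewrite lN linearN /=; lra.
have FD y y' i k : exists k', F (y + y') k' <= F y i + F y' k.
  exists (i + k); rewrite /F lD linearD /= opprD addrACA.
  by have := ps.1 (y - j i) (y' - j k); lra.
have FZ a y i : 0 < a -> exists k, F (a *: y) k <= a * F y i.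
  move=> a0; exists (a *: i); rewrite /F lZ linearZ /= -scalerBr.
  by rewrite mulrDr lerD2r; exact: ps.2.
have [L LF] := sublinear_ge_scalar (sublinear_inf 0 Fbnd FD FZ).
have {}LF x e : L x <= F x e := le_trans (LF x) (inf_family_le Fbnd x e).
exists L; split=> [x|e].
  by have := LF x 0; rewrite /F linear0 l0 subr0 addr0.
have le' e' : L (j e') <= l e'.
  by have := LF (j e') e'; rewrite /F subrr (sublinear0 ps) add0r.
apply/eqP; rewrite eq_le le' /=.
by have := le' (- e); rewrite lN !linearN lerN2.
Qed.

End Hahn_Banach.

(** * Rademacher averages *)

Section finitely_supported.
Context {R : realType} (I : choiceType) (V : lmodType R).

Definition finsupp_pred : {pred (I -> V)} :=
  mem [set f : I -> V | exists s : seq I, forall i, i \notin s -> f i = 0].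

Lemma finsupp_predP (f : I -> V) :
  reflect (exists s : seq I, forall i, i \notin s -> f i = 0)
          (f \in finsupp_pred).
Proof. by apply: (iffP idP); rewrite /finsupp_pred inE. Qed.

Lemma finsupp_submod_closed : submod_closed finsupp_pred.
Proof.
split=> [|a f g /finsupp_predP[s fs] /finsupp_predP[t gt]]; apply/finsupp_predP.
  by exists [::].
exists (s ++ t) => i; rewrite mem_cat negb_or => /andP[/fs fi /gt gi].
by rewrite [LHS](_ : _ = a *: f i + g i)// fi gi scaler0 addr0.
Qed.

HB.instance Definition _ := GRing.isSubmodClosed.Build _ _ finsupp_pred
  finsupp_submod_closed.

Record finsupp := Finsupp {
  finsupp_val :> I -> V; finsupp_valP : finsupp_val \in finsupp_pred }.

HB.instance Definition _ := [isSub for finsupp_val].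
HB.instance Definition _ := [Choice of finsupp by <:].
HB.instance Definition _ := [SubChoice_isSubLmodule of finsupp by <:].

Lemma single_subproof i x : (fun k => if k == i then x else 0) \in finsupp_pred.
Proof. by apply/finsupp_predP; exists [:: i] => k; rewrite inE => /negbTE ->. Qed.

Definition single i x := Finsupp (single_subproof i x).

Lemma single_linear i : linear (single i).
Proof.
move=> a x y; apply: val_inj; apply/funext => k /=.
rewrite [RHS](_ : _ = a *: single i x k + single i y k)//=.
by case: ifP; rewrite ?scaler0 ?addr0.
Qed.

HB.instance Definition _ i :=
  GRing.isLinear.Build R V finsupp _ (single i) (single_linear i).

End finitely_supported.

Section sums.
Context {R : realType} {I : choiceType}.

Lemma ler_sum_uniq (s t : seq I) (f : I -> R) : uniq s -> (forall i, 0 <= f i) ->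
  (forall i, i \in s -> i \notin t -> f i = 0) ->
  \sum_(i <- s) f i <= \sum_(i <- t) f i.
Proof.
move=> us f0; elim: s us t => [_ t _|i s IH /= /andP[nis us] t st].
  by rewrite big_nil; exact: sumr_ge0.
rewrite big_cons; have [it|nit] := boolP (i \in t); last first.
  rewrite st ?mem_head// add0r; apply: IH => // j js.
  by apply: st; rewrite inE js orbT.
rewrite (big_rem i it) /= lerD2l; apply: IH => // j js jt.
apply: st; first by rewrite inE js orbT.
apply: contra jt => jt; have ji : j != i by apply: contraNneq nis => <-.
by have := perm_mem (perm_to_rem it) j; rewrite jt inE (negbTE ji).
Qed.

Definition total (a : finsupp I R^o) : R := \sum_(i \in [set: I]) a i.

Lemma totalE (s : seq I) (a : finsupp I R^o) : uniq s ->
  (forall i, i \notin s -> a i = 0) -> total a = \sum_(i <- s) a i.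
Proof.
move=> us sa; rewrite /total (fsbigE s)//= => [|i _]; last exact: sa.
by apply: eq_bigl => i; rewrite in_setT.
Qed.

Lemma total_scalar : scalar total.
Proof.
move=> x a b; have /finsupp_predP[s sa] := finsupp_valP a.
have /finsupp_predP[t tb] := finsupp_valP b.
have u : uniq (undup (s ++ t)) := undup_uniq _.
have na i : i \notin undup (s ++ t) -> a i = 0.
  by rewrite mem_undup mem_cat negb_or => /andP[/sa].
have nb i : i \notin undup (s ++ t) -> b i = 0.
  by rewrite mem_undup mem_cat negb_or => /andP[_ /tb].
have E i : (x *: a + b) i = x * a i + b i by [].
rewrite !(totalE u) // => [|i /[dup] /na ai /nb bi]; last first.
  by rewrite E ai bi mulr0 addr0.
by rewrite mulr_sumr -big_split.
Qed.

End sums.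

Section rademacher.
Context {R : realType} {I : choiceType} {X : normedModType R}.

(* The average of |z + \sum_(i <- s) e_i u_i| over all signs e_i = 1, -1. *)
Fixpoint rademacher (s : seq I) (u : I -> X) (z : X) : R :=
  if s is i :: s' then
    (rademacher s' u (z + u i) + rademacher s' u (z - u i)) / 2
  else `|z|.

Lemma rademacherD s u v z w :
  rademacher s (u + v) (z + w) <= rademacher s u z + rademacher s v w.
Proof.
elim: s z w => [|i s IH] z w /=; first exact: ler_normD.
have := IH (z + u i) (w + v i); have := IH (z - u i) (w - v i).
rewrite [(u + v) i](_ : _ = u i + v i)// opprD.
rewrite -[z + u i + (w + v i)]addrACA -[z - u i + (w - v i)]addrACA; lra.
Qed.

Lemma rademacherZ s (a : R) u z : 0 < a ->
  rademacher s (a *: u) (a *: z) = a * rademacher s u z.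
Proof.
move=> a0; elim: s z => [|i s IH] z /=; first by rewrite normrZ gtr0_norm.
rewrite [(a *: u) i](_ : _ = a *: u i)// -scalerDr -scalerBr !IH; lra.
Qed.

Lemma rademacher_le s u z : rademacher s u z <= `|z| + \sum_(i <- s) `|u i|.
Proof.
elim: s z => [|i s IH] z /=; first by rewrite big_nil addr0.
rewrite big_cons; have := IH (z + u i); have := IH (z - u i).
by have := ler_normD z (u i); have := ler_normB z (u i); lra.
Qed.

(* Orthogonality of the signs, with AM-GM to avoid a square root. *)
Lemma rademacher_scale_le s (c : I -> R) (b m : R) (x : X) :
  2 * m * rademacher s (fun i => c i *: x) (b *: x) <=
  `|x| * (b ^+ 2 + \sum_(i <- s) c i ^+ 2 + m ^+ 2).
Proof.
elim: s b => [|i s IH] b /=.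
  rewrite big_nil addr0 normrZ mulrA [leLHS]mulrC ler_wpM2l//.
  by rewrite -real_normK ?num_real//; have := sqr_ge0 (`|b| - m); lra.
rewrite big_cons -scalerDl -scalerBl.
have := IH (b + c i); have := IH (b - c i); rewrite !expr2; lra.
Qed.

End rademacher.

(** * Copies of ell_1 and overcomplete sets *)

Section ell1_unit.
Context {R : realType} {I : choiceType}.

Lemma esum_split (i : I) (f : I -> R) :
  (\esum_(k in [set: I]) `|f k|%:E =
   `|f i|%:E + \esum_(k in ~` [set i]) `|f k|%:E)%E.
Proof.
by rewrite (esumID [set i])// !setTI esum_set1.
Qed.

Lemma ell1_unit_subproof (i : I) : (fun k => (k == i)%:R : R) \in @ell1_pred R I.
Proof.
apply/ell1_predP; rewrite /summable /= (esum_split i) eqxx esum1 ?adde0 ?ltry//.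
by move=> k /= /eqP/negbTE ->; rewrite normr0.
Qed.

Definition ell1_unit (i : I) : ell1 R I := Ell1 (ell1_unit_subproof i).

Lemma ell1_norm_addZ_unit (v : ell1 R I) i (a : R) : v i = 0 ->
  `|v + a *: ell1_unit i| = `|v| + `|a|.
Proof.
move=> vi; set w := v + _.
have E k : w k = v k + a * (k == i)%:R by [].
apply: EFin_inj; rewrite EFinD !ell1_normEFin !(esum_split i).
rewrite !E vi eqxx add0r mulr1 normr0 add0e addeC; congr (_ + _)%E.
apply: eq_esum => k ki; rewrite E (_ : (k == i) = false) ?mulr0 ?addr0//.
exact/eqP.
Qed.

(** All choices of signs give combinations of the same ell_1 norm, so the lower bound for [T] passes
    to the average. The vector [v] collects the units that the induction has already signed. *)
Lemma le_rademacher_ell1 (X : normedModType R) (T : {linear ell1 R I -> X})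
    (c : R) (s : seq I) (a : I -> R) (v : ell1 R I) :
  (forall x, c * `|x| <= `|T x|) -> uniq s -> {in s, forall i, v i = 0} ->
  c * (`|v| + \sum_(i <- s) `|a i|) <=
  rademacher s (fun i => a i *: T (ell1_unit i)) (T v).
Proof.
move=> cT; elim: s v => [|i s IH] v /=; first by rewrite big_nil addr0.
move=> /andP[nis us] vs; rewrite big_cons.
have vi : v i = 0 by apply: vs; rewrite mem_head.
have H b : c * (`|v| + `|b| + \sum_(j <- s) `|a j|) <=
    rademacher s (fun i => a i *: T (ell1_unit i)) (T v + b *: T (ell1_unit i)).
  rewrite -linearZ -linearD -(ell1_norm_addZ_unit b vi); apply: IH => // j js.
  have ji : j != i by apply: contraNneq nis => <-.
  rewrite [LHS](_ : _ = v j + b * (j == i)%:R)// (negbTE ji) mulr0 addr0.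
  by apply: vs; rewrite inE js orbT.
by have := H (a i); have := H (- a i); rewrite normrN scaleNr; lra.
Qed.

End ell1_unit.

Section rademacher_norm.
Context {R : realType} {I : choiceType} {X : normedModType R}.

(** The supremum over all lists spares the choice of a support and is finite by [rademacher_le];
    [undup] keeps an index from receiving two signs. *)
Definition rademacher_norm (u : finsupp I X) : R :=
  sup (range (fun s : seq I => rademacher (undup s) u 0)).

Lemma le_rademacher_norm (u : finsupp I X) (s : seq I) : uniq s ->
  rademacher s u 0 <= rademacher_norm u.
Proof.
move=> us; have /finsupp_predP[t ut] := finsupp_valP u.
apply: ub_le_sup; last by exists s; rewrite ?undup_id.
exists (\sum_(i <- t) `|u i|) => _ [r _ <-].
apply: le_trans (rademacher_le _ _ _) _; rewrite normr0 add0r.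
apply: ler_sum_uniq => [||i _ /ut ->]; rewrite ?normr0 ?undup_uniq//.
Qed.

Lemma rademacher_norm_le (u : finsupp I X) b :
  (forall s, uniq s -> rademacher s u 0 <= b) -> rademacher_norm u <= b.
Proof.
move=> ub; apply: ge_sup => [|_ [s _ <-]]; last exact/ub/undup_uniq.
by exists (rademacher (undup [::]) u 0), [::].
Qed.

Lemma rademacher_norm_sublinear : sublinear rademacher_norm.
Proof.
split=> [u v|a u a0]; apply: rademacher_norm_le => s us.
  rewrite -[0 in leLHS]addr0; apply: le_trans (rademacherD _ _ _ _ _) _.
  by apply: lerD; exact: le_rademacher_norm.
rewrite -[0 in leLHS](scaler0 _ a) rademacherZ// ler_pM2l//.
exact: le_rademacher_norm.
Qed.

Lemma sum_single (s : seq I) (g : I -> X) k : uniq s ->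
  (\sum_(i <- s) single i (g i)) k = if k \in s then g k else 0.
Proof.
elim: s => [|i s IH] /=; first by rewrite big_nil.
move=> /andP[nis us]; rewrite big_cons.
rewrite [LHS](_ : _ = (if k == i then g i else 0) +
  (\sum_(j <- s) single j (g j)) k)// IH// inE.
by have [->|] := eqVneq k i; rewrite ?(negbTE nis) ?addr0 ?add0r.
Qed.

(** With [n = size s], the best choice [m = sqrt n] would bound the norm by [sqrt n * |x|]. This
    growth, slower than [n], is what forces countable supports; a free [m] avoids the square
    root. *)
Lemma rademacher_norm_sum_single (s : seq I) (c : I -> R) (x : X) (m : R) :
  uniq s -> 0 < m -> (forall i, c i ^+ 2 <= 1) ->
  2 * m * rademacher_norm (\sum_(i <- s) single i (c i *: x)) <=
  `|x| * ((size s)%:R + m ^+ 2).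
Proof.
move=> us m0 c1; have m20 : 0 < 2 * m by rewrite mulr_gt0.
rewrite -ler_pdivlMl//; apply: rademacher_norm_le => t ut.
rewrite ler_pdivlMl//; pose b k := if k \in s then c k else 0.
have -> : finsupp_val (\sum_(i <- s) single i (c i *: x)) = fun k => b k *: x.
  apply/funext => k; rewrite sum_single// /b; case: ifP => //.
  by rewrite scale0r.
rewrite -[0 in leLHS](scale0r x); apply: le_trans (rademacher_scale_le _ _ _ _ _) _.
rewrite expr0n add0r ler_wpM2l// lerD2r.
apply: (@le_trans _ _ (\sum_(i <- s) b i ^+ 2)).
  apply: ler_sum_uniq => // [i|i _ /negbTE is_]; first exact: sqr_ge0.
  by rewrite /b is_ expr0n.
rewrite -sum1_size natr_sum; apply: ler_sum => i _; rewrite /b.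
by case: ifP; rewrite ?expr0n.
Qed.

Lemma rademacher_norm_single i (x : X) : rademacher_norm (single i x) <= `|x|.
Proof.
have := @rademacher_norm_sum_single [:: i] (fun=> 1) x 1 isT ltr01.
by rewrite big_seq1 scale1r !expr1n => /(_ (fun=> lexx _)) /=; lra.
Qed.

End rademacher_norm.

(* Operators from ell_1(I) into ell_2(I), such as the formal identity, are
   2-summing and extend to superspaces: the f i are the coordinates of such an
   extension, whence the countable supports. *)
Lemma ell1_copy_functionals (R : realType) (I : choiceType)
    (X : normedModType R) (T : {linear ell1 R I -> X}) (c : R) :
  0 < c -> (forall v, c * `|v| <= `|T v|) ->
  exists f : I -> {scalar X},
    [/\ forall i x, c * `|f i x| <= `|x|, forall i, exists x, f i x = 1 &
        forall x, countable [set i | f i x != 0]].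
Proof.
move=> c0 cT.
pose emb (a : finsupp I R^o) : I -> X := fun i => a i *: T (ell1_unit i).
have embP a : emb a \in @finsupp_pred R I X.
  have /finsupp_predP[s sa] := finsupp_valP a; apply/finsupp_predP.
  by exists s => i /sa ai; rewrite /emb ai scale0r.
pose j a := Finsupp (embP a).
have jlin : linear j.
  move=> t a b; apply: val_inj; apply/funext => i /=.
  rewrite [RHS](_ : _ = t *: emb a i + emb b i)// /emb.
  rewrite [X in X *: _](_ : _ = t * a i + b i)//.
  by rewrite scalerDl scalerA.
pose jL := GRing.isLinear.Build R (finsupp I R^o) (finsupp I X) _ j jlin.
pose J : {linear finsupp I R^o -> finsupp I X} := HB.pack j jL.
have ps : sublinear (fun u : finsupp I X => c^-1 * rademacher_norm u).
  have [pD pZ] := @rademacher_norm_sublinear R I X.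
  split=> [u v|a u a0]; first by rewrite -mulrDr ler_pM2l ?invr_gt0.
  by rewrite mulrCA ler_pM2l ?invr_gt0//; exact: pZ.
have lp a : total a <= c^-1 * rademacher_norm (J a).
  have /finsupp_predP[s sa] := finsupp_valP a.
  have us := undup_uniq s; rewrite ler_pdivlMl//.
  apply: le_trans (le_rademacher_norm _ us).
  rewrite (totalE us) => [|i]; last by rewrite mem_undup; exact: sa.
  have := @le_rademacher_ell1 _ _ _ _ _ (undup s) a 0 cT us (fun _ _ => erefl).
  rewrite normr0 add0r linear0; apply: le_trans.
  by rewrite ler_pM2l//; apply: ler_sum => i _; exact: ler_norm.
have [L [Lp LJ]] := Hahn_Banach ps (@total_scalar R I) lp.
have {}Lp u : c * L u <= rademacher_norm u by rewrite -ler_pdivlMl.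
pose f i : {scalar X} := L \o single i.
have fE i x : f i x = L (single i x) by [].
exists f; split=> [i x|i|x].
- have /le_trans Lx := Lp (single i x); have := Lx _ (rademacher_norm_single i x).
  have /le_trans Ly := Lp (single i (- x)).
  have := Ly _ (rademacher_norm_single i (- x)).
  rewrite normrN -!fE raddfN /= => h2 h1.
  by have [h|h] := lerP 0 (f i x); [rewrite ger0_norm|rewrite ltr0_norm].
- exists (T (ell1_unit i)).
  have -> : f i (T (ell1_unit i)) = L (J (single i 1)).
    rewrite fE; congr (L _); apply: val_inj; apply/funext => k /=.
    by rewrite /emb /=; case: eqP => [->|]; rewrite ?scale1r ?scale0r.
  rewrite LJ (@totalE _ _ [:: i])// ?big_seq1 /= ?eqxx// => k.
  by rewrite inE => /negbTE ->.
have fin n : finite_set [set i | n.+1%:R^-1 <= `|f i x|].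
  apply: contrapT => inf; set del : R := n.+1%:R^-1 in inf.
  have del0 : 0 < del by rewrite invr_gt0.
  (* With the signs of [f i x] as coefficients on [n = size s] indices, [c * del * n] is at most
     [|x| * (n + m^2) / (2 * m)]. This [m] turns the comparison into
     [2 * (|x| + 1) * n <= |x| * (n + m^2)], which is false once [n > |x| * m^2]. *)
  pose m := (`|x| + 1) / (c * del).
  have cd0 : 0 < c * del by rewrite mulr_gt0.
  have m0 : 0 < m by rewrite divr_gt0// ltr_wpDl.
  have mcd : m * (c * del) = `|x| + 1 by rewrite divfK ?gt_eqF.
  pose N := Num.bound (`|x| * m ^+ 2).
  have [s sD sN] := infinite_set_fset N inf.
  have us := fset_uniq s.
  have := rademacher_norm_sum_single x us m0 (c := fun i => Num.sg (f i x)).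
  have sg1 i : Num.sg (f i x) ^+ 2 <= 1.
    by rewrite sqr_sg; case: (_ != 0).
  move=> /(_ sg1); set u := \sum_(i <- _) _ => up.
  have Lu : del * (size s)%:R <= L u.
    rewrite linear_sum -sum1_size natr_sum mulr_sumr big_seq [leRHS]big_seq.
    apply: ler_sum => i /sD; rewrite mulr1 => /= h; apply: (le_trans h).
    by rewrite linearZ linearZ /= normrEsg.
  have sN' : `|x| * m ^+ 2 < (size s)%:R.
    apply: (lt_le_trans (archi_boundP _)); first by rewrite mulr_ge0// sqr_ge0.
    by rewrite ler_nat.
  have h1 : 2 * m * (c * (del * (size s)%:R)) <= `|x| * ((size s)%:R + m ^+ 2).
    apply: le_trans up; rewrite (ler_pM2l (mulr_gt0 (ltr0Sn R 1) m0)).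
    by apply: le_trans (Lp u); rewrite ler_pM2l.
  have h2 : 2 * m * (c * (del * (size s)%:R)) = 2 * (`|x| + 1) * (size s)%:R.
    by rewrite -mcd; ring.
  have := normr_ge0 x; have : (0 : R) <= (size s)%:R by [].
  by move: h1 sN'; rewrite h2; nra.
rewrite (_ : [set i | _] = \bigcup_n [set i | n.+1%:R^-1 <= `|f i x|]).
  by apply: bigcup_countable => // n _; exact/finite_set_countable.
apply/seteqP; split=> [i /= fi|i [n _ /=]].
  exists (Num.bound (`|f i x|^-1)) => //=.
  have fi0 : 0 < `|f i x| by rewrite normr_gt0.
  rewrite invf_ple ?posrE//; apply/ltW/(lt_trans (archi_boundP _)).
    by rewrite invr_ge0.
  by rewrite ltr_nat.
by apply: contraTneq => ->; rewrite normr0 -ltNge invr_gt0.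
Qed.

(** * Densities, kernels and the conclusion *)

Lemma has_density_card_eq (R : realType) (X : normedModType R) (T U : Type)
    (A : set T) (B : set U) : has_density X A -> has_density X B -> A #= B.
Proof.
move=> [[A' dA' AA'] minA] [[B' dB' BB'] minB]; apply/card_eqPle; split.
- apply: card_le_trans (minA _ dB') _.
  by have /card_eqPle[] := BB'.
- apply: card_le_trans (minB _ dA') _.
  by have /card_eqPle[] := AA'.
Qed.

(** The ball of radius [c * |f x|] around [x] misses the kernel of [f], hence the span of any set on
    which [f] vanishes. *)
Lemma linearly_dense_not_annihilated (R : realType) (X : normedModType R)
    (f : {scalar X}) (c : R) (Z : set X) (x : X) :
  0 < c -> (forall x, c * `|f x| <= `|x|) -> f x != 0 ->
  linearly_dense Z -> exists2 z, Z z & f z != 0.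
Proof.
move=> c0 fc fx dZ; apply: contrapT => nZ.
have fspan y : Defs.span Z y -> f y = 0.
  move=> [n [a [v [vZ ->]]]]; rewrite linear_sum big1// => i _.
  rewrite linearZ /=; have [->|fv] := eqVneq (f (v i)) 0; first by rewrite mulr0.
  by exfalso; apply: nZ; exists (v i).
have e0 : 0 < c * `|f x| by rewrite mulr_gt0// normr_gt0.
have [||y [/interior_subset By Sy]] := dZ (ball x (c * `|f x|))°.
- by exists x; exact: nbhsx_ballx.
- exact: open_interior.
move: By; rewrite -ball_normE /=; apply/negP; rewrite -leNgt.
by have := fc (x - y); rewrite linearB /= (fspan _ Sy) subr0.
Qed.

Local Close Scope ring_scope.

Theorem theorem37 (R : realType)
  (d : Order.disp_t) (K : orderType d) (K_card : is_cardinal K)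
  (d' : Order.disp_t) (W : orderType d') (W_omega1 : is_omega1 W)
  (cfK : cofinality_gt K [set: W])
  (X : completeNormedModType R) (X_inf : infinite_dimensional X)
  (X_dens : has_density X [set: K])
  (X_ell1 : contains_isomorphic_copy X (ell1 R W)) :
  ~ exists Y : set X, overcomplete Y.
Proof.
move=> [Y [Y_dens Y_over]].
have [_ W_unc _] := W_omega1.
have [T [c [C [c0 _ TcC]]]] := X_ell1.
have [f [fc f1 f_count]] := ell1_copy_functionals c0
  (fun v => proj1 (elimT andP (TcC v))).
have YK := has_density_card_eq Y_dens X_dens.
have /card_eqPle[YleK KleY] := YK.
have [g [gY ginj]] := card_le_fun (0%R : X) KleY.
(* The cover consists of indices in [K] rather than points of [Y], to fit the pigeonhole
   principle. *)
pose A (w : W) := [set k | f w (g k) = 0%R].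
have [|k|w _ KA] := @cofinality_pigeonhole _ K W [set: W] A K_card _ cfK.
- by move=> /finite_set_countable.
(* An index [k] outside every [A w] would have [f w (g k) != 0] for all [w], against the countable
   support. *)
- apply: contrapT => nA; apply: W_unc.
  apply: sub_countable (f_count (g k)); apply: subset_card_le => w _ /=.
  by apply/eqP => fw; apply: nA; exists w.
have [x fx] := f1 w.
(* The image of [A w] under [g] is a part of [Y] of full cardinality inside the kernel of [f w].
   Overcompleteness makes it linearly dense, yet [f w] is nonzero at [x]. *)
have [||z [k Ak <-] /eqP[]] := @linearly_dense_not_annihilated _ _ (f w) c
    (g @` A w) x c0 (fc w); last by exact: Ak.
- by rewrite fx oner_neq0.
- apply: Y_over => [_ [k _ <-]|]; first exact: gY.
  apply/card_eqPle; split; first by apply: subset_card_le => _ [k _ <-]; exact: gY.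
  apply: (card_le_trans YleK); apply: (card_le_trans KA).
  by apply: (card_le_inj (f := g)) => [k Ak|k l _ _ /ginj]; [exists k|apply].
Qed.
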